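(* Let $r>0$ be an integer and for $i\in\{1,\dots,r\}$ let $X_i$ be a finite set and $G_i\le\mathrm{Sym}(X_i)$. Let $G=G_1\times\dots\times G_r$ act on the disjoint union $X_1\,\dot\cup\,\cdots\,\dot\cup\,X_r$ via $x(g_1,\dots,g_r)=xg_i$ for $x\in X_i$. If $C\subseteq G$ is a nonempty subset of the form $C=C_1\times\dots\times C_r$ with each $C_i\subseteq G_i$, then for every integer $k\ge 0$ $$\delta_k(C)=\sum_{k_1+\dots+k_r=k}\ \prod_{i=1}^r\delta_{k_i}(C_i)\qquad\text{and hence}\qquad\delta(C)=\prod_{i=1}^r\delta(C_i),$$ where the sum is over all $r$-tuples $(k_1,\dots,k_r)$ of nonnegative integers with $k_1+\dots+k_r=k$.
   Context: Permutations act on the right. For a nonempty finite set $C$ of permutations of a finite set $X$, $\delta_k(C)$ is the proportion of elements of $C$ with exactly $k$ fixed points in $X$, and $\delta(C)=\delta_0(C)$. Here $\delta_k(C)$ is taken with respect to the action on $X_1\,\dot\cup\,\cdots\,\dot\cup\,X_r$, and $\delta_{k_i}(C_i)$ with respect to the action on $X_i$. *)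

(* Defs.v *)
From HB Require Import structures.
From mathcomp Require Import all_boot all_order all_algebra all_fingroup.

Set Implicit Arguments.
Unset Strict Implicit.
Unset Printing Implicit Defensive.

Import GRing.Theory.

Local Open Scope ring_scope.

(* Only meaningful for C nonempty; the value is 0 (= 0 / 0) when C is empty. *)
Definition fix_proportion (gT : finGroupType) (D : {set gT}) (T : finType)
    (to : action D T) (k : nat) (C : {set gT}) : rat :=
  #|[set g in C | #|('Fix_to[g])%g| == k]|%:R / #|C|%:R.

Definition derangement_proportion (gT : finGroupType) (D : {set gT})
    (T : finType) (to : action D T) (C : {set gT}) : rat :=
  fix_proportion to 0 C.

Notation perm_prod X := {dffun forall i, {perm X i}}.
Notation disjoint_union X := {i & X i}.

Section DisjointUnionAction.

Variables (r : nat) (X : 'I_r -> finType).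

Definition disjoint_union_fun (x : disjoint_union X) (g : perm_prod X) :
    disjoint_union X :=
  Tagged (fun i => X i) (g (tag x) (tagged x)).

Fact disjoint_union_fun1 : disjoint_union_fun^~ 1%g =1 id.
Proof. by case=> i x; rewrite /disjoint_union_fun /= ffunE perm1. Qed.

Fact disjoint_union_funM : forall x, act_morph disjoint_union_fun x.
Proof.
by case=> i x g h /=; rewrite /disjoint_union_fun /= ffunE permM.
Qed.

Definition disjoint_union_total_action : {action perm_prod X &-> disjoint_union X} :=
  TotalAction disjoint_union_fun1 disjoint_union_funM.

Variable G : forall i : 'I_r, {group {perm X i}}.

Definition prod_group : {group perm_prod X} := setXn_group G.

Definition disjoint_union_action : action prod_group (disjoint_union X) :=
  (disjoint_union_total_action \ subsetT prod_group)%act.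

End DisjointUnionAction.

(* Main.v *)
Require Import Defs.
From mathcomp Require Import all_boot all_order all_algebra all_fingroup.

Set Implicit Arguments.
Unset Strict Implicit.
Unset Printing Implicit Defensive.

Local Open Scope ring_scope.

Import GRing.Theory.

(** The action preserves each summand, so the fixed points of a tuple are the disjoint union of
    those of its coordinates, and their numbers add up ([card_fix_disjoint_union]). Sorting the
    tuples of a product set by their coordinatewise counts cuts it into smaller product sets, whose
    sizes are products ([card_setXn_sum]). Dividing by [#|C|], the product of the [#|Ci i|], gives
    the convolution formula; for [k = 0] only the zero tuple contributes. *)

Lemma card_fix_disjoint_union (r : nat) (X : 'I_r -> finType)
    (G : forall i : 'I_r, {group {perm X i}}) (g : perm_prod X) :
  #|afix (disjoint_union_action G) [set g]|
    = (\sum_(i < r) #|afix ('P \ subsetT (G i)) [set g i]|)%N.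
Proof.
under eq_bigr do rewrite -sum1_card.
rewrite -sum1_card (sig_big_dep (fun _ => true)) /=.
apply: eq_bigl => -[i x]; apply/afix1P/afix1P; rewrite /= /ract /disjoint_union_fun /=.
  by move=> /eqP; rewrite eq_Tagged => /eqP.
by rewrite /aperm => ->.
Qed.

(** The conditions [f i (g i) = ks i] constrain each coordinate separately, so every fibre of [g]
    over a tuple of values is again a product set. Each value is at most the total [k], hence the
    finite index type ['I_k.+1] loses nothing. *)
Lemma card_setXn_sum (I : finType) (T : I -> finType)
    (A : forall i, {set T i}) (f : forall i, T i -> nat) (k : nat) :
  #|[set g in setXn A | (\sum_i f i (g i))%N == k]|
    = (\sum_(ks : {ffun I -> 'I_k.+1} | (\sum_i ks i)%N == k)
         \prod_i #|[set x in A i | f i x == ks i]|)%N.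
Proof.
(* [inord] falls back to a default on values above [k]; [F] is faithful only on tuples with total
   [k], which is what [FE] records. *)
pose F (g : {dffun forall i, T i}) : {ffun I -> 'I_k.+1} :=
  [ffun i => inord (f i (g i))].
have FE (g : {dffun forall i, T i}) :
    (\sum_i f i (g i))%N == k -> forall i, F g i = f i (g i) :> nat.
  move=> /eqP gk i; rewrite ffunE inordK // ltnS -gk.
  by rewrite (bigD1 i) //= leq_addr.
rewrite -sum1_card (partition_big F (fun ks => (\sum_i ks i)%N == k)) /=; last first.
  move=> g; rewrite inE => /andP[_ gk]; rewrite -[X in _ == X](eqP gk).
  by apply/eqP/eq_bigr => i _; rewrite FE.
(* Reading the product of sizes as the size of a [setXn] leaves only an equality of sets: the fibre
   of [F] over [ks] against the product of the slices. *)
apply: eq_bigr => ks /eqP ksk; rewrite -cardsXn -sum1_card.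
apply: eq_bigl => g; rewrite [in LHS]inE; apply/andP/setXnP => [[/andP[/setXnP gA gk] /eqP <-] i|gA].
  by rewrite inE gA FE //=.
have gE i : f i (g i) = ks i by have := gA i; rewrite inE => /andP[_ /eqP].
split; last by apply/eqP/ffunP => i; apply/val_inj; rewrite ffunE gE /= inordK.
apply/andP; split; first by apply/setXnP => i; have := gA i; rewrite inE => /andP[].
by apply/eqP; rewrite -{}[RHS]ksk; apply: eq_bigr.
Qed.

Theorem theorem4p3 (r : nat) (hr : (0 < r)%N) (X : 'I_r -> finType)
    (G : forall i : 'I_r, {group {perm X i}})
    (Ci : forall i : 'I_r, {set {perm X i}}) (C : {set perm_prod X})
    (hCi : forall i : 'I_r, Ci i \subset G i)
    (hCG : C \subset prod_group G)
    (hC : C = setXn Ci)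
    (hC0 : C != set0) :
  (forall k : nat,
     fix_proportion (disjoint_union_action G) k C =
     \sum_(ks : {ffun 'I_r -> 'I_k.+1} | ((\sum_(i < r) ks i)%N == k))
        \prod_(i < r) fix_proportion ('P \ subsetT (G i)) (ks i) (Ci i)) /\
  derangement_proportion (disjoint_union_action G) C =
  \prod_(i < r) derangement_proportion ('P \ subsetT (G i)) (Ci i).
Proof.
have delta_k k : fix_proportion (disjoint_union_action G) k C =
     \sum_(ks : {ffun 'I_r -> 'I_k.+1} | ((\sum_(i < r) ks i)%N == k))
        \prod_(i < r) fix_proportion ('P \ subsetT (G i)) (ks i) (Ci i).
  rewrite /fix_proportion hC cardsXn.
  under eq_finset do rewrite card_fix_disjoint_union.
  rewrite (card_setXn_sum Ci (fun i x => #|afix ('P \ subsetT (G i)) [set x]|)).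
  rewrite natr_sum mulr_suml; apply: eq_bigr => ks _.
  by rewrite !natr_prod -prodf_div.
split=> //; rewrite /derangement_proportion delta_k.
(* For [k = 0] the entries lie in ['I_1], a singleton, so the zero tuple is the only index and the
   rest of the sum is empty. *)
rewrite (bigD1 [ffun=> ord0]) /=; last by rewrite big1 // => i _; rewrite ffunE.
rewrite [X in _ + X]big1 ?addr0 => [|ks /andP[_ /eqP[]]].
  by apply: eq_bigr => i _; rewrite ffunE.
by apply/ffunP => i; rewrite ffunE [LHS]ord1.
Qed.
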